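(* Let $Q$ be a network with root $O$ (satisfying the standing assumption in the context) and suppose that $\sup_{r>0} f_Q(r)/r\le \alpha\,\deg_Q(O)$ for some $\alpha>1$. Then the expanding search $S^*$, $S^*(t)=Q[g_Q(t)]$, approximates the optimal randomized expanding competitive ratio of $Q$ within a factor of at most $\alpha$, i.e. $$\sup_{H\in Q}\hat T(S^*,H)\le \alpha\,\rho(Q).$$
   Context: A network $Q$ is a connected metric graph made of vertices and arcs (possibly unbounded), with a distinguished root vertex $O$, endowed with Lebesgue (length) measure $\lambda$; $\mu=\lambda(Q)\in(0,\infty]$ is its total measure. $d(x)$ is the length of a shortest path from $O$ to $x$. $\deg_Q(v)$ is the number of arcs incident to $v$ (a loop at $v$ being counted twice). Standing assumption: there is an integer $N$ such that $|\{x\in Q: d(x)=r\}|\le N$ for all $r>0$. For $r\ge 0$, $Q[r]=\{x\in Q: d(x)\le r\}$, $f_Q(r)=\lambda(Q[r])$, and $r_{\max}=\sup_{x\in Q}d(x)$ (possibly $\infty$). On $[0,r_{\max}]$ (on $[0,\infty)$ if $r_{\max}=\infty$) $f_Q$ is strictly increasing; $g_Q$ denotes its inverse. $S^*$ is defined for $0\le t\le\mu$, $t<\infty$. An expanding search is a family of connected subsets $S(t)\subset Q$, $0\le t\le\mu$ ($t<\infty$), with $S(0)=\{O\}$, $S(t)\subset S(t')$ for $t\le t'$, and $\lambda(S(t))=t$ for all $t$. The search time of $H\in Q$ is $T(S,H)=\min\{t: H\in S(t)\}$; the normalized search time is $\hat T(S,H)=T(S,H)/d(H)$ for $H\ne O$,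 and $\hat T(S,O)=0$. A randomized search $s$ is a probability distribution over expanding searches; $\hat T(s,H)$ is the expected normalized search time; $\rho(Q)=\inf_s\sup_{H\in Q}\hat T(s,H)$. *)

(* Defs.v *)
From HB Require Import structures.
From mathcomp Require Import all_boot all_order all_algebra.
From mathcomp Require Import all_classical all_reals all_analysis.
From mathcomp Require Import measurable_realfun.

Set Implicit Arguments.
Unset Strict Implicit.
Unset Printing Implicit Defensive.

Import Order.TTheory GRing.Theory Num.Theory.
Import numFieldNormedType.Exports.

Local Open Scope classical_set_scope.
Local Open Scope ring_scope.

(* An arc [e] with [arc_end e = Some (v, l)] is a bounded arc of length [l]
   joining [arc_start e] to [v]; if [arc_end e = None] it is an unbounded arc
   (a half-line) issued from [arc_start e].  Loops, parallel arcs and infinitely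
   many arcs are allowed. *)
Record metric_graph (R : realType) := MetricGraph {
  vertex : choiceType;
  arc_of : choiceType;
  arc_start : arc_of -> vertex;
  arc_end : arc_of -> option (vertex * {posnum R})
}.

Definition arc_length (R : realType) (G : metric_graph R) (e : arc_of G) :
    \bar R :=
  if arc_end e is Some (_, l) then (l%:num)%:E else +oo%E.

(* The set of points is the disjoint union of the vertices and of the open arcs;
   a point of an open arc is given by its distance to the start along the arc. *)
Inductive gpoint (R : realType) (G : metric_graph R) : Type :=
| Vertex of vertex G
| Interior (e : arc_of G) (s : R) of (0 < s%:E < arc_length e)%E.

HB.instance Definition _ (R : realType) (G : metric_graph R) :=
  gen_eqMixin (gpoint G).
HB.instance Definition _ (R : realType) (G : metric_graph R) :=
  gen_choiceMixin (gpoint G).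

Section MetricGraph.
Variables (R : realType) (G : metric_graph R).

Definition open_arc (e : arc_of G) : set R :=
  [set s | (0 < s%:E < arc_length e)%E].

Definition closed_arc (e : arc_of G) : set R :=
  [set s | (0 <= s%:E <= arc_length e)%E].

(* Arc length parametrization of [e], meant to be used on [closed_arc e]. *)
Definition chart (e : arc_of G) (s : R) : gpoint G :=
  match @idP (0 < s%:E < arc_length e)%E with
  | ReflectT h => Interior h
  | ReflectF _ =>
      if s <= 0 then Vertex (arc_start e)
      else if arc_end e is Some (v, _) then Vertex v
      else Vertex (arc_start e)
  end.

(* [walk p q l]: some finite concatenation of arc segments, of total length [l],
   leads from [p] to [q]. *)
Inductive walk : gpoint G -> gpoint G -> R -> Prop :=
| walk_nil p : walk p p 0
| walk_cons e s t q l : closed_arc e s -> closed_arc e t ->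
    walk (chart e t) q l -> walk (chart e s) q (`|s - t| + l).

Lemma walk_cat p q r l m : walk p q l -> walk q r m -> walk p r (l + m).
Proof.
move=> pq; elim: pq m => [x|e s t x k es et _ ih] m xr; first by rewrite add0r.
by rewrite -addrA; apply: walk_cons => //; exact: ih.
Qed.

Lemma walk_sym p q l : walk p q l -> walk q p l.
Proof.
elim=> [x|e s t x k es et _ ih]; first exact: walk_nil.
rewrite addrC; apply: walk_cat ih _.
by rewrite distrC -[X in walk _ _ X]addr0; apply: walk_cons => //;
   exact: walk_nil.
Qed.

(* The topology of the metric graph is that of its path metric, that is,
   the infimum of the lengths of the walks between two points. *)
Definition walk_ball (p : gpoint G) (r : R) (q : gpoint G) : Prop :=
  exists2 l, walk p q l & l < r.

Let walk_nbhs := nbhs_ (entourage_ walk_ball).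

HB.instance Definition _ := hasNbhs.Build (gpoint G) walk_nbhs.

Let walk_nbhsE : nbhs = nbhs_ (entourage_ walk_ball) :> (gpoint G -> _).
Proof. by []. Qed.

Let walk_ball_center p (r : R) : 0 < r -> walk_ball p r p.
Proof. by exists 0 => //; exact: walk_nil. Qed.

Let walk_ball_sym p q (r : R) : walk_ball p r q -> walk_ball q r p.
Proof. by case=> l pq lr; exists l => //; exact: walk_sym. Qed.

Let walk_ball_triangle p q x (r s : R) :
  walk_ball p r q -> walk_ball q s x -> walk_ball p (r + s) x.
Proof.
move=> [l pq lr] [m qx ms]; exists (l + m); first exact: walk_cat qx.
exact: ltrD.
Qed.

HB.instance Definition _ := @Nbhs_isPseudoMetric.Build R (gpoint G)
  (entourage_ walk_ball) walk_nbhsE walk_ball walk_ball_center walk_ball_sym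
  walk_ball_triangle erefl.

(* Length measure: each open arc carries Lebesgue measure, vertices are null.
   [lebesgue_measure] is total (it is the Lebesgue outer measure), and a
   connected subset of [gpoint G] meets each open arc in at most two intervals. *)
Definition length_measure (A : set (gpoint G)) : \bar R :=
  esum [set: arc_of G]
    (fun e => lebesgue_measure (open_arc e `&` chart e @^-1` A)).

(* Number of arcs incident to [v]: a loop at [v] both starts and ends at [v],
   hence is counted twice. *)
Definition degree (v : vertex G) : \bar R :=
  (counting [set e : arc_of G | arc_start e = v] +
   counting [set e : arc_of G | omap fst (arc_end e) = Some v])%E.

End MetricGraph.

Record network (R : realType) := Network {
  network_graph :> metric_graph R;
  root_vertex : vertex network_graph;
  network_connected : forall p q : gpoint network_graph, exists l, walk p q l
}.

Section Search.
Variables (R : realType) (Q : network R).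

Definition origin : gpoint Q := Vertex (root_vertex Q).

Definition root_dist (x : gpoint Q) : R := inf [set l | walk origin x l].

Definition total_length : \bar R := length_measure [set: gpoint Q].

Definition bounded_spheres : Prop :=
  exists N : nat, forall r : R, 0 < r ->
    ([set x : gpoint Q | root_dist x = r] #<= `I_N)%card.

Definition disc (r : R) : set (gpoint Q) := [set x | root_dist x <= r].

Definition f_Q (r : R) : \bar R := length_measure (disc r).

Definition r_max : \bar R :=
  ereal_sup [set (root_dist x)%:E | x in [set: gpoint Q]].

(* Inverse of [f_Q] restricted to the real points of [0, r_max]. *)
Definition g_Q (t : R) : R :=
  xget 0 [set r | [/\ 0 <= r, (r%:E <= r_max)%E & f_Q r = t%:E]].

Definition search_domain : set R := [set t | (0 <= t%:E <= total_length)%E].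

(* Only the values of [S] on [search_domain] matter. *)
Definition expanding_search (S : R -> set (gpoint Q)) : Prop :=
  [/\ S 0 = [set origin],
      {in search_domain &, forall t t', t <= t' -> S t `<=` S t'},
      {in search_domain, forall t, connected (S t)} &
      {in search_domain, forall t, length_measure (S t) = t%:E}].

(* [S_star t] is the closed disc of length [t] around the root. *)
Definition S_star (t : R) : set (gpoint Q) := disc (g_Q t).

(* Infimum rather than minimum, since the minimum need not be attained if the
   sets [S t] are not closed; [+oo] if [H] is never found. *)
Definition search_time (S : R -> set (gpoint Q)) (H : gpoint Q) : \bar R :=
  ereal_inf [set t%:E | t in search_domain `&` [set t | S t H]].

Definition normalized_search_time (S : R -> set (gpoint Q)) (H : gpoint Q) :
    \bar R :=
  if H == origin then 0%E else (search_time S H * ((root_dist H)^-1)%:E)%E.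

(* A probability distribution over expanding searches, presented as the law of
   a random expanding search with measurable search times. *)
Record randomized_search := RandomizedSearch {
  sample_display : measure_display;
  sample_space : measurableType sample_display;
  sample_law : probability sample_space R;
  pure_search : sample_space -> R -> set (gpoint Q);
  pure_searchP : forall w, expanding_search (pure_search w);
  measurable_search_time : forall H,
    measurable_fun [set: sample_space] (fun w => search_time (pure_search w) H)
}.

Definition expected_normalized_search_time
    (s : randomized_search) (H : gpoint Q) : \bar R :=
  (\int[sample_law s]_w normalized_search_time (@pure_search s w) H)%E.

(* Optimal randomized expanding competitive ratio. *)
Definition rho : \bar R :=
  ereal_inf
    [set v | exists s : randomized_search,
      v = ereal_sup (range (expected_normalized_search_time s))].

End Search.

Arguments S_star {R} Q t.

(* Main.v *)
Require Import Defs.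
From HB Require Import structures.
From mathcomp Require Import all_boot all_order all_algebra.
From mathcomp Require Import all_classical all_reals all_analysis.
From mathcomp Require Import measurable_realfun.
From mathcomp Require Import finmap lra ring.

Import Order.TTheory GRing.Theory Num.Theory.
Import numFieldNormedType.Exports.

Local Open Scope classical_set_scope.
Local Open Scope ring_scope.

(** The theorem compares both sides with the degree of the root.

    Upper bound ([normalized_S_star_le]).  The search [S_star] explores discs
    around the root, so it finds a point at distance [r] at time [f_Q r], and its
    normalized search time there is [f_Q r / r], which the hypothesis bounds by
    [alpha] times the degree.  What has to be checked is that [g_Q] really
    inverts [f_Q], that is, that [f_Q] is strictly increasing ([f_Q_gap]).

    Lower bound ([degree_le_rho]).  Every randomized search has ratio at least the
    number [n] of arc ends at the root.  Near the root, any [n] arc ends form a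
    star with [n] rays; the target is hidden on this star, on a ray chosen
    uniformly and at a distance chosen log-uniformly, in a discrete form: at
    distance [k eta] with weight [1 / k], for [1 <= k <= K].
    - A connected set containing the root which reaches a grid point contains
      either the segment before it or a far longer segment beyond it
      ([connected_end]); hence a search needs time at least [eta] times the
      number of grid points found no later than a given one
      ([search_time_grid]).
    - The weighted normalized time is thus at least the sum over pairs of grid
      points [(p, q)], with [q] found no later than [p], of [1 / k p ^ 2].
      Symmetrizing in [p] and [q] removes the dependence on the search: the sum
      is at least half that of [1 / max (k p) (k q) ^ 2] over all pairs, which
      is [n ^ 2 * (H - 1)] or more, [H] being the [K]-th harmonic number.
    - The total weight is [n H], so the ratio is at least [n - n / H], and [K]
      tends to infinity ([arc_ends_le_ratio]). *)

(** * The path metric of a metric graph *)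

Section WalkMetric.
Set Implicit Arguments.
Unset Strict Implicit.
Variables (R : realType).

(** Stated for an arbitrary pseudometric domain because it is applied both to
    functions on the graph and to their pullbacks to the real line. *)
Lemma ball_lipschitz_continuous (T : pseudoMetricType R) (phi : T -> R) :
  (forall x y r, ball x r y -> `|phi x - phi y| < r) -> continuous phi.
Proof.
move=> phiL x; apply/cvgrPdist_lt => r r0.
near=> y; apply: phiL; near: y; exact: nbhsx_ballx.
Unshelve. all: by end_near. Qed.

Variable G : metric_graph R.
Implicit Types (e : arc_of G) (p q : gpoint G).

Lemma chart_interior e s (h : (0 < s%:E < arc_length e)%E) :
  chart e s = Interior h.
Proof.
rewrite /chart; destruct idP as [h'|] => //.
by rewrite (bool_irrelevance h' h).
Qed.

Lemma chart_vertex e s : ~ open_arc e s -> chart e s =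
  Vertex (if s <= 0 then arc_start e
          else if arc_end e is Some (v, _) then v else arc_start e).
Proof.
move=> out; rewrite /chart; destruct idP as [|] => //.
by case: ifP => // _; case: arc_end => [[]|].
Qed.

Lemma chart0 e : chart e 0 = Vertex (arc_start e).
Proof. by rewrite chart_vertex ?lexx// /open_arc /= ltxx. Qed.

Lemma chart_end e v (l : {posnum R}) :
  arc_end e = Some (v, l) -> chart e l%:num = Vertex v.
Proof.
move=> el; rewrite chart_vertex; first by rewrite leNgt gt0 /= el.
by rewrite /open_arc /arc_length /= el ltxx andbF.
Qed.

Lemma walk_ge0 p q l : walk p q l -> 0 <= l.
Proof. by elim=> // *; rewrite addr_ge0. Qed.

Lemma walk_chart e s t :
  closed_arc e s -> closed_arc e t -> walk (chart e s) (chart e t) `|s - t|.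
Proof.
move=> es et; rewrite -[X in walk _ _ X]addr0.
by apply: walk_cons => //; exact: walk_nil.
Qed.

(** A walk is a chain of moves inside single arcs, so that a Lipschitz bound
    for the path metric may be checked arc by arc. *)
Lemma lipschitz_walk (phi : gpoint G -> R) :
  (forall e s t, closed_arc e s -> closed_arc e t ->
    `|phi (chart e s) - phi (chart e t)| <= `|s - t|) ->
  forall p q l, walk p q l -> `|phi p - phi q| <= l.
Proof.
move=> phiL p q l; elim=> [x|e s t x k es et _ ih]; first by rewrite subrr normr0.
by apply: le_trans (ler_distD (phi (chart e t)) _ _) _; rewrite lerD// phiL.
Qed.

Lemma lipschitz_walk_continuous (phi : gpoint G -> R) :
  (forall p q l, walk p q l -> `|phi p - phi q| <= l) -> continuous phi.
Proof.
move=> phiL; apply: ball_lipschitz_continuous => x y r [l xy lr].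
exact: le_lt_trans (phiL _ _ _ xy) lr.
Qed.

(** On the arc [e] this is the signed depth of a point inside [[a, b]],
    truncated at [- rho]; it is constant off the arc, the truncation making the
    two prescriptions agree at the ends of [e].  It serves as a barrier: being
    1-Lipschitz for the path metric, it forbids short cuts to the inside of an
    arc. *)
Definition tent e (a b rho : R) q : R :=
  if q is Interior e' s _ then
    if e' == e then Num.max (- rho) (Num.min (s - a) (b - s)) else - rho
  else - rho.

Lemma tent_chart e a b rho (rho_a : rho <= a)
    (rho_b : ((b + rho)%:E <= arc_length e)%E) e' s : closed_arc e' s ->
  tent e a b rho (chart e' s) =
  if e' == e then Num.max (- rho) (Num.min (s - a) (b - s)) else - rho.
Proof.
move=> /andP[s0 sl].
have [/chart_interior->//|out] := boolP (0 < s%:E < arc_length e')%E.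
have -> : tent e a b rho (chart e' s) = - rho.
  by rewrite chart_vertex//; exact/negP.
case: eqP => // e'e; subst e'; apply/esym/max_l; rewrite ge_min; apply/orP.
move: out; rewrite negb_and -!leNgt => /orP[sn|ls]; [left|right].
  have {}sn : s <= 0 by rewrite -lee_fin.
  have : s - a <= - rho by lra.
  by [].
have lb : b + rho <= s by rewrite -lee_fin (le_trans rho_b ls).
have : b - s <= - rho by lra.
by [].
Qed.

Lemma tent_walk e a b rho (rho_a : rho <= a)
    (rho_b : ((b + rho)%:E <= arc_length e)%E) p q l :
  walk p q l -> `|tent e a b rho p - tent e a b rho q| <= l.
Proof.
apply: lipschitz_walk => e' s t es et; rewrite !tent_chart//.
case: ifP => _; last by rewrite subrr normr0.
have := ler_norm (s - t); have := ler_norm (- (s - t)).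
rewrite normrN ler_norml => h1 h2.
by case: (leP (s - a)) => ?; case: (leP (t - a)) => ?;
  do 2![case: (leP (- rho)) => ?]; apply/andP; split; lra.
Qed.

Lemma max_min_eq0 (rho x a b : R) : 0 < rho ->
  0 = Num.max (- rho) (Num.min (x - a) (b - x)) -> x = a \/ x = b.
Proof.
move=> rho0; case: (leP (x - a)) => _; case: (leP (- rho)) => _ ?;
  first [by left; lra|by right; lra|by exfalso; lra].
Qed.

Lemma exists_margin e a b : (0 < a%:E)%E -> (b%:E < arc_length e)%E ->
  exists rho : R, [/\ 0 < rho, rho <= a & ((b + rho)%:E <= arc_length e)%E].
Proof.
rewrite lte_fin => a0; case: (arc_length e) => [l| |]//; last first.
  by exists a; split; rewrite // leey.
rewrite lte_fin => bl; exists (Num.min a (l - b)); split.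
- by rewrite lt_min a0 subr_gt0.
- by rewrite ge_min lexx.
- by rewrite lee_fin -lerBrDl ge_min lexx orbT.
Qed.

(** The points of [C] strictly between [a] and [b] are those where the tent
    over [[a, b]] is positive; if [a] and [b] are both missing from [C] they are
    also those where it is nonnegative, so they form a clopen part of [C], which
    must be everything or nothing. *)
Lemma connected_arc_cut e a b s (C : set (gpoint G)) v : connected C ->
  open_arc e a -> open_arc e b -> a < s < b ->
  C (Vertex v) -> C (chart e s) -> C (chart e a) \/ C (chart e b).
Proof.
move=> cC /= /andP[a0 al] /andP[b0 bl] /andP[as_ sb] Cv Cs.
apply: contrapT => /not_orP[Ca Cb].
have [rho [rho0 rhoa rhob]] := exists_margin a0 bl.
set phi := tent e a b rho.
have phic : continuous phi.
  by apply: lipschitz_walk_continuous => p q l; exact: tent_walk.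
have clo x : a <= x <= b -> closed_arc e x.
  move=> /andP[ax xb]; apply/andP; split.
    by rewrite lee_fin (le_trans _ ax)// -lee_fin ltW.
  by rewrite (le_trans _ (ltW bl))// lee_fin.
suff : C `&` [set q | 0 < phi q] = C.
  move=> /seteqP[_ /(_ _ Cv)[_ /=]]; rewrite oppr_gt0; lra.
apply: cC.
- exists (chart e s); split => //=.
  rewrite /phi tent_chart ?eqxx//; last by apply: clo; rewrite !ltW.
  by rewrite lt_max lt_min !subr_gt0 as_ sb orbT.
- exists [set q | 0 < phi q] => //.
  exact: (iffLR (continuousP phi) phic _ (@open_gt R 0)).
- exists [set q | 0 <= phi q].
    exact: (iffLR (continuous_closedP phi) phic _ (@closed_ge R 0)).
  apply/seteqP; split=> q [Cq /= h]; split=> //=; first exact: ltW.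
  move: h; rewrite le_eqVlt => /orP[/eqP|//].
  case: q Cq => [w|e' x h] Cq; rewrite /phi /=; first lra.
  case: eqP => [ee|_]; last lra.
  subst e'.
  have xE := chart_interior h; rewrite -xE in Cq.
  by move=> /(max_min_eq0 rho0)[xE'|xE']; rewrite xE' in Cq.
Qed.

(** Retraction of the line onto the parameter interval of [e], so that
    functions of the arc length parameter become functions on the whole line and
    the intermediate value theorem and measurability of preimages apply as they
    stand. *)
Definition clamp e (x : R) : R :=
  if arc_end e is Some (_, l) then Num.min l%:num (Num.max 0 x)
  else Num.max 0 x.

Lemma clamp_closed e x : closed_arc e (clamp e x).
Proof.
rewrite /closed_arc /clamp /arc_length /=; case: arc_end => [[_ l]|] /=.
  by rewrite !lee_fin le_min ge_min le_max !lexx ge0.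
by rewrite lee_fin leey le_max lexx.
Qed.

Lemma clamp_id e x : closed_arc e x -> clamp e x = x.
Proof.
rewrite /closed_arc /clamp /arc_length /=; case: arc_end => [[_ l]|] /=.
  by rewrite !lee_fin => /andP[x0 xl]; rewrite max_r// min_r.
by rewrite lee_fin => /andP[x0 _]; rewrite max_r.
Qed.

Lemma clamp_lipschitz e x y : `|clamp e x - clamp e y| <= `|x - y|.
Proof.
have := ler_norm (x - y); have := ler_norm (- (x - y)).
rewrite normrN ler_norml /clamp => h1 h2.
case: arc_end => [[_ l]|].
  by case: (leP 0 x) => ?; case: (leP 0 y) => ?;
    do ?[case: (leP l%:num) => ?]; apply/andP; split; lra.
by do 2![case: (leP 0) => ?]; apply/andP; split; lra.
Qed.

End WalkMetric.

(** * Distance to the root and growth of discs *)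

Section Distance.
Set Implicit Arguments.
Unset Strict Implicit.
Variables (R : realType) (Q : network R).
Implicit Types (p q : gpoint Q) (r : R).

Lemma root_dist_le (x : gpoint Q) l : walk (origin Q) x l -> root_dist x <= l.
Proof.
by move=> Ox; apply: ge_inf => //; exists 0 => k /=; exact: walk_ge0.
Qed.

Lemma root_dist_lb (x : gpoint Q) b :
  (forall l, walk (origin Q) x l -> b <= l) -> b <= root_dist x.
Proof.
move=> h; apply: lb_le_inf => //.
by have [l Ox] := network_connected (origin Q) x; exists l.
Qed.

Lemma root_dist_ge0 (x : gpoint Q) : 0 <= root_dist x.
Proof. by apply: root_dist_lb => l; exact: walk_ge0. Qed.

Lemma root_dist_origin : root_dist (origin Q) = 0.
Proof.
by apply/le_anti; rewrite root_dist_ge0 andbT root_dist_le//; exact: walk_nil.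
Qed.

Lemma root_dist_walk p q l :
  walk p q l -> `|root_dist p - root_dist q| <= l.
Proof.
have le (x y : gpoint Q) k : walk x y k -> root_dist y <= root_dist x + k.
  move=> xy; rewrite -lerBlDr; apply: root_dist_lb => m Ox.
  by rewrite lerBlDr root_dist_le//; exact: walk_cat xy.
move=> pq; rewrite ler_distl lerBlDr le//= le//.
exact: walk_sym.
Qed.

Definition arc_dist (e : arc_of Q) (s : R) : R := root_dist (chart e (clamp e s)).

Lemma arc_dist_lipschitz e s t : `|arc_dist e s - arc_dist e t| <= `|s - t|.
Proof.
apply: le_trans (clamp_lipschitz e s t).
by apply: root_dist_walk; apply: walk_chart; exact: clamp_closed.
Qed.

Lemma arc_dist_continuous e : continuous (arc_dist e).
Proof.
apply: ball_lipschitz_continuous => s t r.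
by apply: le_lt_trans; exact: arc_dist_lipschitz.
Qed.

(** Reduces the crossing of the sphere of radius [r], which a walk may achieve
    anywhere, to a question about one real function. *)
Lemma walk_crossing r p q l :
  walk p q l -> root_dist p <= r -> r < root_dist q ->
  exists e s t, [/\ closed_arc e s, closed_arc e t,
    arc_dist e s <= r & r < arc_dist e t].
Proof.
elim=> [x|e s t x k es et _ ih] pr qr.
  by move: (le_lt_trans pr qr); rewrite ltxx.
have [|tr] := leP (root_dist (chart e t)) r; first by move=> /ih; exact.
by exists e, s, t; rewrite /arc_dist !clamp_id.
Qed.

(** The function takes a value strictly between [r] and both [r'] and [F t];
    being Lipschitz it stays between [r] and [r'] on a whole interval next to
    the point where that value is taken. *)
Lemma lipschitz_crossing (F : R -> R) (s t r r' : R) :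
  (forall x y : R, `|F x - F y| <= `|x - y|) -> F s <= r -> r < F t -> r < r' ->
  exists u w, [/\ Num.min s t <= u, u < w, w <= Num.max s t &
    forall x, u < x < w -> r < F x < r'].
Proof.
move: F s t.
suff main F s t : (forall x y : R, `|F x - F y| <= `|x - y|) -> F s <= r ->
    r < F t -> r < r' -> s < t ->
    exists u w, [/\ s <= u, u < w, w <= t & forall x, u < x < w -> r < F x < r'].
  move=> F s t FL Fs Ft rr'; have [st|ts|ste] := ltgtP s t.
  - exact: main.
  - have NL (x y : R) : `|(F \o -%R) x - (F \o -%R) y| <= `|x - y|.
      by rewrite (le_trans (FL _ _))// -opprD normrN.
    have := main _ (- s) (- t) NL; rewrite /= !opprK ltrN2.
    move=> /(_ Fs Ft rr' ts)[u [w [su uw wt h]]].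
    exists (- w), (- u); split; [lra|lra|lra|move=> x xwu].
    by rewrite -[x]opprK; apply: h; lra.
  - by move: (le_lt_trans Fs Ft); rewrite ste ltxx.
move=> FL Fs Ft rr' st.
have Fc : continuous F.
  by apply: ball_lipschitz_continuous => x y e; apply: le_lt_trans; exact: FL.
(* The intermediate value is the midpoint of [r] and [m], at distance [d] from
   both. *)
pose m := Num.min r' (F t).
have mr : r < m by rewrite lt_min rr'.
have mr' : m <= r' by rewrite ge_min lexx.
have mt : m <= F t by rewrite ge_min lexx orbT.
have [|c] := @IVT _ F s t ((r + m) / 2) (ltW st) (continuous_subspaceT Fc).
  by rewrite ge_min le_max; apply/andP; split; apply/orP; [left|right]; lra.
rewrite in_itv /= => /andP[sc ct] Fcv.
pose d := (m - r) / 2.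
have d0 : 0 < d by rewrite /d; lra.
have sc' : s < c.
  by rewrite lt_neqAle sc andbT; apply/eqP => E; move: Fs; rewrite E Fcv; lra.
exists (Num.max s (c - d)), c; split => //.
- by rewrite le_max lexx.
- by rewrite gt_max sc'; lra.
- move=> x; rewrite gt_max => /andP[/andP[_ cx] xc].
  have := FL x c; rewrite Fcv [X in _ <= X]ltr0_norm ?subr_lt0//.
  by rewrite ler_norml => /andP[h1 h2]; rewrite /d in cx; lra.
Qed.

Lemma measurable_open_arc (e : arc_of Q) : measurable (open_arc e : set R).
Proof.
rewrite /open_arc /arc_length; case: arc_end => [[_ l]|].
  rewrite (_ : mkset _ = [set` `]0, l%:num[]); first exact: measurable_itv.
  by apply/seteqP; split => s /=; rewrite !lte_fin in_itv.
rewrite (_ : mkset _ = [set` `]0, +oo[]); first exact: measurable_itv.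
by apply/seteqP; split => s /=; rewrite !lte_fin in_itv /= ltry.
Qed.

Lemma open_closed_arc (e : arc_of Q) s : open_arc e s -> closed_arc e s.
Proof. by move=> /andP[/ltW ? /ltW ?]; apply/andP. Qed.

Lemma measurable_disc_arc (e : arc_of Q) r :
  measurable (open_arc e `&` chart e @^-1` disc r : set R).
Proof.
rewrite (_ : _ `&` _ = open_arc e `&` arc_dist e @^-1` [set y | y <= r]); last first.
  by apply/seteqP; split => s [es /=]; rewrite /disc /arc_dist /= clamp_id//;
    exact: open_closed_arc.
apply: measurableI; first exact: measurable_open_arc.
apply: closed_measurable.
exact: (iffLR (continuous_closedP (arc_dist e)) (@arc_dist_continuous e) _
  (@closed_le R r)).
Qed.

(** Monotone on all sets, the Lebesgue measure being extended to them as an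
    outer measure: a search region needs no proof of measurability. *)
Lemma le_lebesgue_measure (A B : set R) :
  A `<=` B -> (lebesgue_measure A <= lebesgue_measure B)%E.
Proof.
move=> AB; rewrite /lebesgue_measure /lebesgue_stieltjes_measure /=.
by rewrite /measure_extension; exact: le_mu_ext.
Qed.

Lemma le_length_measure (A B : set (gpoint Q)) :
  A `<=` B -> (length_measure A <= length_measure B)%E.
Proof.
by move=> AB; apply: le_esum => e _; apply: le_lebesgue_measure => s [? /AB].
Qed.

Lemma length_measure_ge0 (A : set (gpoint Q)) : (0 <= length_measure A)%E.
Proof. exact: esum_ge0. Qed.

Lemma esum_single (e : arc_of Q) (c : \bar R) : (0 <= c)%E ->
  esum [set: arc_of Q] (fun e' => if e' == e then c else 0%E) = c.
Proof.
move=> c0; rewrite -[RHS](@esum_set1 _ _ e (fun=> c))// [RHS]esum_mkcond.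
apply: eq_esum => e' _; have [->|ne] := eqVneq e' e; first by rewrite mem_set.
by rewrite memNset// => /= ee; rewrite ee eqxx in ne.
Qed.

(** Quantitative form of the strict growth of [f_Q].  A walk to a point at
    distance more than [r] crosses the annulus between [r] and [r'] inside some
    arc, and an interval of that arc lies in the larger disc but not in the
    smaller one.  Stating the gap as an added constant makes it meaningful in
    the extended reals. *)
Lemma f_Q_gap r r' : 0 <= r -> r < r' -> (r'%:E <= r_max Q)%E ->
  exists2 c : R, 0 < c & (f_Q Q r + c%:E <= f_Q Q r')%E.
Proof.
move=> r0 rr' r'max.
have /ereal_sup_gt[_ [x _ <-]] : (r%:E < r_max Q)%E by rewrite (lt_le_trans _ r'max).
rewrite lte_fin => rx.
have [l Ox] := network_connected (origin Q) x.
have [|e [s [t [es et sr rt]]]] := walk_crossing Ox _ rx.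
  by rewrite root_dist_origin.
have [u [w [su uw wt h]]] := lipschitz_crossing (@arc_dist_lipschitz e) sr rt rr'.
exists (w - u); first by rewrite subr_gt0.
have J y : u < y < w -> open_arc e y.
  move=> /andP[uy yw]; have := le_lt_trans su uy; have := lt_le_trans yw wt.
  move: es et; rewrite gt_min lt_max => /andP[s0 sl] /andP[t0 tl] ys sy.
  apply/andP; split.
    case/orP: sy => h'; rewrite lte_fin (le_lt_trans _ h')//.
  case/orP: ys => h'; [apply: lt_le_trans sl|apply: lt_le_trans tl];
    by rewrite lte_fin.
rewrite -(@esum_single e (w - u)%:E) ?lee_fin ?subr_ge0 ?(ltW uw)//.
rewrite /f_Q /length_measure -esumD//; last first.
  by move=> e' _; case: ifP => _ //; rewrite lee_fin subr_ge0 ltW.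
apply: le_esum => e' _; case: eqP => [->|_]; last first.
  rewrite adde0; apply: le_lebesgue_measure => y [? /= yr]; split => //=.
  exact: le_trans yr (ltW rr').
have -> : (w - u)%:E = lebesgue_measure [set` `]u, w[].
  by rewrite lebesgue_measure_itv /= lte_fin uw.
rewrite -measureU//; last 2 first.
- exact: measurable_disc_arc.
- rewrite -subset0 => y [[ey /= yr]]; rewrite in_itv => /h.
  by rewrite /arc_dist clamp_id ?ltNge ?yr//; exact: open_closed_arc.
apply: le_lebesgue_measure => y [[ey yr]|].
  by split => //; exact: le_trans yr (ltW rr').
rewrite /= in_itv /= => yuw; split; first exact: J.
have /andP[_] := h _ yuw; rewrite /arc_dist clamp_id; first exact: ltW.
exact/open_closed_arc/J.
Qed.

(** [g_Q] picks some preimage; strict growth leaves only one. *)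
Lemma g_Q_f_Q r : 0 <= r -> (r%:E <= r_max Q)%E -> (f_Q Q r < +oo)%E ->
  g_Q Q (fine (f_Q Q r)) = r.
Proof.
move=> r0 rmax fr.
have frE : f_Q Q r = (fine (f_Q Q r))%:E.
  by rewrite fineK// ge0_fin_numE// length_measure_ge0.
have uniq a b c : 0 <= a -> (b%:E <= r_max Q)%E -> f_Q Q a = c%:E ->
    f_Q Q b = c%:E -> b <= a.
  move=> a0 bmax fa fb; rewrite leNgt; apply/negP => ab.
  have [k k0] := f_Q_gap a0 ab bmax.
  by rewrite fa fb lee_fin; lra.
rewrite /g_Q; case: xgetP => [y _ [y0 ymax fy]|/(_ r)]; last by case.
by apply/le_anti; rewrite (uniq r y _ _ _ frE fy)// (uniq y r _ _ _ fy frE).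
Qed.

(** At time [f_Q (root_dist x)] the search [S_star] has reached radius
    [root_dist x]. *)
Lemma normalized_S_star_le (x : gpoint Q) : (f_Q Q (root_dist x) < +oo)%E ->
  (normalized_search_time (S_star Q) x <=
   f_Q Q (root_dist x) * ((root_dist x)^-1)%:E)%E.
Proof.
move=> fx; rewrite /normalized_search_time; case: ifP => _.
  by rewrite mule_ge0 ?length_measure_ge0// lee_fin invr_ge0 root_dist_ge0.
rewrite lee_wpmul2r ?lee_fin ?invr_ge0 ?root_dist_ge0//.
have fE : (fine (f_Q Q (root_dist x)))%:E = f_Q Q (root_dist x).
  by rewrite fineK// ge0_fin_numE// length_measure_ge0.
apply: ereal_inf_lbound; exists (fine (f_Q Q (root_dist x))) => //.
split; rewrite /search_domain /S_star /=.
  by rewrite fE length_measure_ge0 le_length_measure.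
rewrite /disc /= g_Q_f_Q ?root_dist_ge0//.
by apply: ereal_sup_ubound; exists x.
Qed.

End Distance.

(** * Searching a neighbourhood of the root *)

Section ArcEnds.
Set Implicit Arguments.
Unset Strict Implicit.
Variables (R : realType) (Q : network R).

(** Disjointness is only asked of segments of the same arc, distinct arcs being
    disjoint already.  The sum over segments is split according to the arc that
    carries each of them, and additivity is used arc by arc. *)
Lemma length_measure_segments (C : set (gpoint Q)) (I : finType) (P : pred I)
    (e : I -> arc_of Q) (u w : I -> R) :
  (forall i, P i -> u i <= w i) ->
  (forall i x, P i -> u i < x < w i -> open_arc (e i) x /\ C (chart (e i) x)) ->
  (forall i j, P i -> P j -> i != j -> e i = e j -> w i <= u j \/ w j <= u i) ->
  ((\sum_(i | P i) (w i - u i))%:E <= length_measure C)%E.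
Proof.
move=> uw inC disj; rewrite -sumEFin.
rewrite (eq_bigr (fun i => esum [set: arc_of Q]
    (fun e' => if e' == e i then (w i - u i)%:E else 0%E))); last first.
  by move=> i Pi; rewrite esum_single// lee_fin subr_ge0 uw.
rewrite -esum_sum; last first.
  by move=> e' i _ Pi; case: ifP => // _; rewrite lee_fin subr_ge0 uw.
apply: le_esum => e' _; rewrite -big_mkcondr /=.
pose J i : set R := [set` `]u i, w i[].
rewrite (eq_bigr (fun i => lebesgue_measure (J i))); last first.
  move=> i /andP[/uw uwi _]; rewrite lebesgue_measure_itv /= lte_fin EFinB.
  by move: uwi; rewrite le_eqVlt => /orP[/eqP->|->//]; rewrite ltxx subee.
rewrite (bigfs _ (index_enum_uniq I)); last by move=> i _; rewrite mem_index_enum.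
rewrite -measure_fin_bigcup//; last 2 first.
- apply/classical_sets.trivIsetP => i j /andP[Pi /eqP ei] /andP[Pj /eqP ej] ij.
  rewrite -subset0 => x [] /=; rewrite /J /= !in_itv /=.
  move=> /andP[xi1 xi2] /andP[xj1 xj2].
  by have [] := disj i j Pi Pj ij _; [rewrite -ei|lra|lra].
- by move=> i _; exact: measurable_itv.
apply: le_lebesgue_measure => x [i /andP[Pi /eqP ->]] ; rewrite /J /= in_itv /=.
exact: inC.
Qed.

Lemma length_measure_segment (C : set (gpoint Q)) (e : arc_of Q) (u w : R) :
  u <= w -> (forall x, u < x < w -> open_arc e x /\ C (chart e x)) ->
  ((w - u)%:E <= length_measure C)%E.
Proof.
move=> uw inC.
have := @length_measure_segments C unit predT (fun=> e) (fun=> u) (fun=> w).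
rewrite (big_pred1 tt); last by case.
apply => //.
by move=> _ x _; exact: inC.
Qed.

(** The tent at the point itself is a 1-Lipschitz function which separates it
    from all vertices.  Vertices may well be at distance 0 from the root when
    infinitely many arcs accumulate. *)
Lemma root_dist_gt0 (e : arc_of Q) (s : R) :
  open_arc e s -> 0 < root_dist (chart e s).
Proof.
move=> /[dup] /open_closed_arc es /andP[s0 sl].
have [rho [rho0 rhos rhol]] := exists_margin s0 sl.
apply: (lt_le_trans rho0); apply: root_dist_lb => l.
move=> /(tent_walk rhos rhol); apply: le_trans.
rewrite [in leRHS]tent_chart// eqxx subrr minxx max_r ?oppr_le0 ?(ltW rho0)//.
by rewrite subr0 normrN gtr0_norm.
Qed.

(** An arc end is a pair [(e, b)]: [b] tells whether [e] is entered from its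
    end rather than from its start.  A loop at the root thus has two ends there,
    as in the definition of the degree. *)
Definition starts_at_root (a : arc_of Q * bool) : Prop :=
  if a.2 then omap fst (arc_end a.1) = Some (root_vertex Q)
  else arc_start a.1 = root_vertex Q.

Definition end_coord (a : arc_of Q * bool) (x : R) : R :=
  if a.2 then fine (arc_length a.1) - x else x.

(** Twice [h], so that the initial segments of length [h] at the two ends of a
    loop are disjoint. *)
Definition has_room (a : arc_of Q * bool) (h : R) : Prop :=
  ((h + h)%:E < arc_length a.1)%E.

Definition end_point (a : arc_of Q * bool) (x : R) : gpoint Q :=
  chart a.1 (end_coord a x).

Section End.
Variables (a : arc_of Q * bool) (h : R).

Lemma end_lengthE : starts_at_root a -> a.2 ->
  arc_length a.1 = (fine (arc_length a.1))%:E.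
Proof.
by rewrite /starts_at_root /arc_length => + b; rewrite b; case: arc_end => [[]|].
Qed.

Lemma end_point0 : starts_at_root a -> closed_arc a.1 (end_coord a 0) /\
  end_point a 0 = origin Q.
Proof.
rewrite /starts_at_root /end_point /closed_arc /end_coord /arc_length /origin.
case: a => e [] /=.
  case ee : arc_end => [[v l]|] //= [<-]; rewrite subr0 !lee_fin lexx.
  by split; [rewrite ge0|exact: chart_end].
move=> <-; rewrite lexx chart0; split => //.
by case: arc_end => [[_ l]|] //=; rewrite ?lee_fin ?leey.
Qed.

Lemma end_coord_open x : starts_at_root a -> has_room a h -> 0 < x -> x <= h + h ->
  open_arc a.1 (end_coord a x).
Proof.
move=> aO ah x0 xh; have xl : (x%:E < arc_length a.1)%E.
  by apply: le_lt_trans ah; rewrite lee_fin.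
rewrite /open_arc /end_coord /=; case b: a.2; last by rewrite lte_fin x0.
rewrite (end_lengthE aO b) /= !lte_fin.
by move: xl; rewrite (end_lengthE aO b) /= lte_fin; lra.
Qed.

Lemma end_coord_isometry x y : `|end_coord a x - end_coord a y| = `|x - y|.
Proof.
rewrite /end_coord; case: a.2 => //; set l := fine _.
by (have -> : l - x - (l - y) = y - x by lra); exact: distrC.
Qed.

Lemma end_point_dist x : starts_at_root a -> has_room a h -> 0 < x -> x <= h + h ->
  0 < root_dist (end_point a x) <= x.
Proof.
move=> aO ah x0 xh; have ax := end_coord_open aO ah x0 xh.
rewrite root_dist_gt0//=; have [a0 aE] := end_point0 aO.
have xE : `|end_coord a 0 - end_coord a x| = x.
  by rewrite end_coord_isometry sub0r normrN gtr0_norm.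
apply: root_dist_le; rewrite -aE -[X in walk _ _ X]xE.
by apply: walk_chart => //; exact: open_closed_arc.
Qed.

(** A connected set that contains the root and a point of an arc end came to it
    either from the root side or from the far side: missing a point on both sides
    is excluded by [connected_arc_cut]. *)
Lemma connected_end (C : set (gpoint Q)) y :
  starts_at_root a -> has_room a h -> connected C -> C (origin Q) ->
  0 < y -> y <= h + h -> C (end_point a y) ->
  (forall x, 0 < x <= y -> C (end_point a x)) \/
  (forall x, y <= x <= h + h -> C (end_point a x)).
Proof.
move=> aO ah cC CO y0 yh Cy; apply: contrapT => /not_orP[].
move=> /existsNP[x /not_implyP[/andP[x0 xy] Cx]].
move=> /existsNP[z /not_implyP[/andP[yz zh] Cz]].
have xNy : x < y by rewrite lt_neqAle xy andbT; apply/eqP => E; rewrite E in Cx.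
have yNz : y < z by rewrite lt_neqAle yz andbT; apply/eqP => E; rewrite -E in Cz.
have ox : open_arc a.1 (end_coord a x) by apply: end_coord_open => //; lra.
have oz : open_arc a.1 (end_coord a z) by apply: end_coord_open => //; lra.
suff [] : C (end_point a x) \/ C (end_point a z) by [].
have [b|b] : end_coord a z < end_coord a y < end_coord a x \/
  end_coord a x < end_coord a y < end_coord a z.
  by rewrite /end_coord; case: a.2; [left|right]; lra.
- by have [] := connected_arc_cut cC oz ox b CO Cy; [right|left].
- by have [] := connected_arc_cut cC ox oz b CO Cy; [left|right].
Qed.

End End.

Lemma finite_room (I : finType) (a : I -> arc_of Q * bool) :
  exists2 h : R, 0 < h & forall i, has_room (a i) h.
Proof.
have room i : exists h : R, 0 < h /\ has_room (a i) h.
  rewrite /has_room /arc_length; case: arc_end => [[_ l]|].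
    have : 0 < l%:num :> R by []; move: l%:num => m m0.
    by exists (m / 3); rewrite lte_fin; split; lra.
  by exists 1; rewrite ltry.
have [f fP] := choice room.
exists (\big[Num.min/1]_i f i).
  by apply/lt_bigmin => [|i _]; [exact: ltr01|case: (fP i)].
move=> i; have [_] := fP i; apply: le_lt_trans.
by rewrite lee_fin lerD//; exact: bigmin_le_cond.
Qed.

Section Grid.
Variables (n K : nat) (a : 'I_n -> arc_of Q * bool) (h eta : R).
Hypotheses (a_inj : injective a) (aO : forall i, starts_at_root (a i)).
Hypotheses (ah : forall i, has_room (a i) h) (eta0 : 0 < eta).
Hypothesis (room : (K + n * K)%:R * eta <= h).

(** The hiding places: [K] equally spaced points, at distances [eta], ...,
    [K eta] from the root, on each of [n] arc ends. *)
Definition grid_point (p : 'I_n * 'I_K) : gpoint Q :=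
  end_point (a p.1) (p.2.+1%:R * eta).

Let le_room k : (k <= K + n * K)%N -> k%:R * eta <= h.
Proof.
by move=> k_le; apply: le_trans room; rewrite ler_wpM2r ?ler_nat// ltW.
Qed.

(** If every grid point of [P] was reached from the root side, [C] contains the
    grid segment just below each of them, and these segments are disjoint.  If
    one was reached from the far side, [C] contains a segment beyond it which is
    as long as all grid segments together, because the grid was chosen small
    compared with the arcs. *)
Lemma connected_grid (C : set (gpoint Q)) (P : pred ('I_n * 'I_K)) :
  connected C -> C (origin Q) -> (forall p, P p -> C (grid_point p)) ->
  (((#|P|)%:R * eta)%:E <= length_measure C)%E.
Proof.
move=> cC CO CP; have eta_gt0 : 0 < eta := eta0.
have room_k (k : 'I_K) : k.+1%:R * eta <= h.
  by apply: le_room; rewrite (leq_trans (ltn_ord k))// leq_addr.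
have k0 (k : nat) : 0 < k.+1%:R * eta by rewrite mulr_gt0.
have h0 : 0 <= h by apply: le_trans room; rewrite mulr_ge0// ltW.
have [[p [Pp outward]]|] := pselect (exists p, P p /\
    forall x, p.2.+1%:R * eta <= x <= h + h -> C (end_point (a p.1) x)).
  have Mh : (n * K)%:R * eta <= h by apply: le_room; rewrite leq_addl.
  have cardP : (#|P|)%:R * eta <= (n * K)%:R * eta.
    rewrite ler_wpM2r ?(ltW eta0)// ler_nat (leq_trans (max_card _))//.
    by rewrite card_prod !card_ord.
  set y := p.2.+1%:R * eta in outward.
  have yh : y <= h := room_k _.
  have y0 : 0 < y := k0 _.
  set m := (n * K)%:R * eta in Mh cardP.
  have m0 : 0 <= m by rewrite mulr_ge0// ltW.
  apply: (@le_trans _ _ m%:E); first by rewrite lee_fin.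
  pose ap := a p.1; pose l := fine (arc_length ap.1).
  pose u := if ap.2 then l - (y + m) else y.
  have inC x : u < x < u + m -> open_arc ap.1 x /\ C (chart ap.1 x).
    move=> ux; pose x' := end_coord ap x.
    have xE : x = end_coord ap x' by rewrite /x' /end_coord; case: ap.2; rewrite ?subKr.
    have x'y : y < x' < y + m.
      by move: ux; rewrite /u /x' /end_coord -/l; case: ap.2; lra.
    split; first by rewrite xE; apply: end_coord_open (aO _) (ah _) _ _; lra.
    by rewrite xE; apply: outward; lra.
  have -> : m = u + m - u by lra.
  by apply: length_measure_segment inC; lra.
move=> /forallNP no_outward.
have inward p x : P p -> 0 < x <= p.2.+1%:R * eta -> C (end_point (a p.1) x).
  move=> Pp; have := no_outward p; have := room_k p.2 => kh.
  have [|inw|out] := connected_end (aO p.1) (ah p.1) cC CO (k0 p.2) _ (CP _ Pp).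
  - lra.
  - by move=> _; exact: inw.
  - by case.
pose l (p : 'I_n * 'I_K) := fine (arc_length (a p.1).1).
pose u (p : 'I_n * 'I_K) :=
  if (a p.1).2 then l p - p.2.+1%:R * eta else p.2%:R * eta.
have -> : (#|P|)%:R * eta = \sum_(p | P p) (u p + eta - u p).
  rewrite (eq_bigr (fun=> eta)); last by move=> p _; lra.
  by rewrite big_const iter_addr addr0 mulr_natl.
have kS (k : 'I_K) : k.+1%:R * eta = k%:R * eta + eta.
  by rewrite -natr1 mulrDl mul1r.
apply: (@length_measure_segments C _ P (fun p => (a p.1).1)).
- by move=> p _; lra.
- move=> p x Pp ux; pose x' := end_coord (a p.1) x.
  have xE : x = end_coord (a p.1) x'.
    by rewrite /x' /end_coord; case: (a p.1).2; rewrite ?subKr.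
  have kx : p.2%:R * eta < x' < p.2.+1%:R * eta.
    by move: ux; rewrite /u /x' /end_coord -/(l p) kS; case: (a p.1).2; lra.
  have k0' : 0 <= p.2%:R * eta by rewrite mulr_ge0// ltW.
  have kh := room_k p.2.
  split; first by rewrite xE; apply: end_coord_open (aO _) (ah _) _ _; lra.
  by rewrite xE; apply: (inward p) => //; lra.
- move=> [i k] [j m] _ _ ij /= eij.
  have kh := room_k k; have mh := room_k m.
  have k0' : 0 <= k%:R * eta by rewrite mulr_ge0// ltW.
  have m0' : 0 <= m%:R * eta by rewrite mulr_ge0// ltW.
  have lE : l (j, m) = l (i, k) by rewrite /l /= eij.
  move: kh mh; rewrite /u /= lE !kS => kh mh.
  have order (p q : nat) : (p < q)%N -> p%:R * eta + eta <= q%:R * eta.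
    by move=> pq; rewrite -[X in _ + X]mul1r -mulrDl natr1 ler_wpM2r ?ler_nat// ltW.
  have same : (a i).2 = (a j).2 -> (k < m)%N \/ (m < k)%N.
    move=> bij; have ij1 : i = j.
      by apply: a_inj; rewrite [a i]surjective_pairing eij bij -surjective_pairing.
    apply/orP; rewrite -neq_ltn; apply: contraNN ij => /eqP km.
    by rewrite ij1 (ord_inj km).
  (* Segments at opposite ends of one arc lie in different halves of it. *)
  have far (p : 'I_n) : l (i, k) = fine (arc_length (a p).1) -> (a p).2 ->
      h + h < l (i, k).
    by move=> -> b; rewrite -lte_fin -(end_lengthE (aO p) b); exact: ah.
  case bi : (a i).2; case bj : (a j).2.
  + by case: same => [|/order|/order]; [rewrite bi bj|right; lra|left; lra].
  + by right; have := far i erefl bi; lra.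
  + by left; have := far j (esym lE) bj; lra.
  + by case: same => [|/order|/order]; [rewrite bi bj|left; lra|right; lra].
Qed.

(** If the time were below the bound, all the grid points counted would lie in
    one search region of length below the bound, against [connected_grid].  That
    region is the largest of finitely many, one for each of these points, since
    a search time is an infimum which need not be attained. *)
Lemma search_time_grid S (p : 'I_n * 'I_K) : expanding_search S ->
  (((#|[pred q | (search_time S (grid_point q) <=
                   search_time S (grid_point p))%E]|)%:R
     * eta)%:E <= search_time S (grid_point p))%E.
Proof.
move=> [S0 Sinc Scon Smeas]; rewrite leNgt; apply/negP => Tp.
set P := [pred q | _] in Tp; set c := (#|P|%:R * eta)%R in Tp.
have c0 : 0 < c.
  by rewrite mulr_gt0// ltr0n; apply/card_gt0P; exists p; rewrite inE /= lexx.
have found q : exists t, P q -> [/\ search_domain Q t, t < c & S t (grid_point q)].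
  have [Pq|nPq] := boolP (P q); last by exists 0.
  have /ereal_inf_lt[_ [t [tdom St] <-]] := le_lt_trans Pq Tp.
  by rewrite lte_fin => tc; exists t.
have [t tP] := choice found.
have dom0 : search_domain Q 0 by rewrite /search_domain /= lexx length_measure_ge0.
pose m := \big[Num.max/0]_(q | P q) t q.
have [mdom mc] : search_domain Q m /\ m < c.
  rewrite /m; elim/big_rec: _ => // q x /tP[tdom tc _] [xdom xc].
  by case: (leP (t q) x).
have Sm : forall x, search_domain Q x -> x <= m -> S x `<=` S m.
  by move=> x xdom xm; apply: Sinc => //; exact: mem_set.
have : (c%:E <= length_measure (S m))%E.
  apply: connected_grid.
  - by apply: Scon; exact: mem_set.
  - by apply: (Sm 0); rewrite ?S0//; case/andP: mdom.
  - move=> q Pq; have [tdom _ St] := tP q Pq.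
    by apply: Sm St => //; exact: le_bigmax_cond.
by rewrite Smeas ?lee_fin ?leNgt ?mc//; exact: mem_set.
Qed.

End Grid.
End ArcEnds.

(** * Rank sums and harmonic sums *)

Section Counting.
Set Implicit Arguments.
Unset Strict Implicit.
Variable R : realType.

(** Pairing [(i, j)] with [(j, i)]: whichever of [t i] and [t j] is the smaller,
    one of [1 / k i ^ 2] and [1 / k j ^ 2] is counted, and it is at least
    [1 / max (k i) (k j) ^ 2].  For a grid of points at distances [k i] this
    averages out the order in which a search finds them. *)
Lemma sum_rank_ge (I : finType) (k : I -> R) d (T : orderType d) (t : I -> T) :
  (forall i, 0 < k i) ->
  \sum_i \sum_j (Num.max (k i) (k j)) ^- 2 <=
  2 * \sum_i (#|[pred j | (t j <= t i)%O]|)%:R / k i ^+ 2.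
Proof.
move=> k0.
have -> : \sum_i (#|[pred j | (t j <= t i)%O]|)%:R / k i ^+ 2 =
    \sum_i \sum_j (t j <= t i)%O%:R / k i ^+ 2.
  apply: eq_bigr => i _; rewrite -mulr_suml -natr_sum; congr (_%:R / _).
  by rewrite -sum1_card big_mkcond; apply: eq_bigr => j _; rewrite inE; case: ifP.
rewrite mulr2n mulrDl mul1r [X in _ <= _ + X]exchange_big -big_split.
apply: ler_sum => i _; rewrite -big_split; apply: ler_sum => j _ /=.
have inv_le (x y : R) : 0 < x -> x <= y -> y ^- 2 <= x ^- 2.
  move=> x0 xy; have y0 := lt_le_trans x0 xy.
  by rewrite lef_pV2 ?posrE ?exprn_gt0// ler_pXn2r ?nnegrE ?(ltW x0) ?(ltW y0).
have inv_ge0 (x : R) : 0 <= x ^- 2 :> R by rewrite invr_ge0 sqr_ge0.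
have [ji|ij] := leP (t j) (t i).
  rewrite mul1r (le_trans (inv_le (k i) _ _ _))// ?le_max ?lexx//.
  by rewrite lerDl mulr_ge0.
rewrite mul0r add0r (ltW ij) mul1r inv_le// le_max lexx orbT //.
Qed.

Lemma sum_snd (n : nat) (I : finType) (F : I -> R) :
  \sum_(p : 'I_n * I) F p.2 = n%:R * \sum_i F i.
Proof.
rewrite -(pair_bigA _ (fun _ i => F i))/= sumr_const card_ord.
by rewrite mulr_natl.
Qed.

Definition harmonic_sum (K : nat) : R := \sum_(k < K) k.+1%:R^-1.

Lemma harmonic_sum_ge1 K : 1 <= harmonic_sum K.+1.
Proof. by rewrite /harmonic_sum big_ord_recl/= invr1 lerDl sumr_ge0. Qed.

Lemma sum_max_step (y D H : R) : 0 < y -> 2 * (H - 1) + y^-1 <= D ->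
  2 * (H + (y + 1)^-1 - 1) + (y + 1)^-1 <=
  D + (y + 1) ^- 2 * y + (y + 1) ^- 2 * (y + 1).
Proof.
move=> y0 ih.
have y1 : 0 < y + 1 by lra.
suff : 0 <= (y + 1) ^- 2 * y + (y + 1) ^- 2 * (y + 1) + y^-1 - 3 * (y + 1)^-1 by lra.
rewrite (_ : _ - _ = (y * (y + 1) ^+ 2)^-1).
  by rewrite invr_ge0 mulr_ge0 ?sqr_ge0// ltW.
by field; rewrite !gt_eqF.
Qed.

(** The shell [max = K] contributes [(2 K - 1) / K ^ 2 = 2 / K - 1 / K ^ 2], and
    the sum of the [1 / K ^ 2] is less than 2. *)
Lemma sum_max_ge K : 2 * (harmonic_sum K.+1 - 1) <=
  \sum_(k < K.+1) \sum_(m < K.+1) (Num.max k.+1%:R m.+1%:R : R) ^- 2.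
Proof.
(* The extra term is the telescoping bound [2 - 1 / K] on the sum of the
   inverse squares, without which the induction does not go through. *)
suff: 2 * (harmonic_sum K.+1 - 1) + K.+1%:R^-1 <=
  \sum_(k < K.+1) \sum_(m < K.+1) (Num.max k.+1%:R m.+1%:R : R) ^- 2.
  by apply: le_trans; rewrite lerDl.
rewrite /harmonic_sum; elim: K => [|K ih].
  by rewrite !big_ord_recl !big_ord0 maxxx expr1n invr1; lra.
rewrite big_ord_recr/= [X in _ <= X]big_ord_recr/=.
have -> : \sum_(k < K.+1) \sum_(m < K.+2) (Num.max k.+1%:R m.+1%:R : R) ^- 2 =
    \sum_(k < K.+1) (\sum_(m < K.+1) (Num.max k.+1%:R m.+1%:R : R) ^- 2 + K.+2%:R ^- 2).
  by apply: eq_bigr => k _; rewrite big_ord_recr/= max_r// ler_nat ltnW// ltnS ltn_ord.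
have -> : \sum_(m < K.+2) (Num.max K.+2%:R m.+1%:R : R) ^- 2 =
    \sum_(m < K.+2) K.+2%:R ^- 2.
  by apply: eq_bigr => m _; rewrite max_l// ler_nat ltn_ord.
rewrite big_split/= !sumr_const !card_ord.
rewrite -[X in _ <= _ + X + _]mulr_natr -[X in _ <= _ + X]mulr_natr -[K.+2%:R]natr1.
exact: sum_max_step ih.
Qed.

Lemma harmonic_sum_unbounded (B : R) : exists K, B < harmonic_sum K.+1.
Proof.
apply: contrapT => /forallNP noK; apply: (@dvg_harmonic R).
have hE K : series harmonic K = harmonic_sum K.
  by rewrite /series /= big_mkord.
have ndH : nondecreasing_seq (series (@harmonic R)).
  by apply: nondecreasing_series => k _ _; exact: harmonic_ge0.
apply: nondecreasing_is_cvgn => //; exists B => _ [K _ <-].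
apply: le_trans (ndH _ _ (leqnSn K)) _; rewrite hE leNgt; exact/negP/noK.
Qed.

Lemma le_of_harmonic_sum (n : nat) (V : R) :
  (forall K, n%:R ^+ 2 * (harmonic_sum K.+1 - 1) <= n%:R * harmonic_sum K.+1 * V) ->
  0 <= V -> n%:R <= V.
Proof.
case: n => // n h V0; rewrite leNgt; apply/negP => Vn.
have [K HK] := harmonic_sum_unbounded (n.+1%:R / (n.+1%:R - V)).
have n0 : 0 < n.+1%:R :> R by [].
move: HK (h K); rewrite ltr_pdivrMr ?subr_gt0// => HK.
rewrite expr2 -!mulrA ler_pM2l//; lra.
Qed.

End Counting.

(** * The degree of the root bounds the competitive ratio *)

Section Expectation.
Set Implicit Arguments.
Unset Strict Implicit.
Variables (R : realType) (Q : network R).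

Lemma search_time_ge0 S (H : gpoint Q) : (0 <= search_time S H)%E.
Proof. by apply: le_ereal_inf_tmp => _ [t [/andP[t0 _] _] <-]. Qed.

Lemma normalized_search_time_ge0 S (H : gpoint Q) :
  (0 <= normalized_search_time S H)%E.
Proof.
rewrite /normalized_search_time; case: ifP => // _.
by rewrite mule_ge0 ?search_time_ge0// lee_fin invr_ge0 root_dist_ge0.
Qed.

Lemma measurable_normalized_search_time (s : randomized_search Q) H :
  measurable_fun setT (fun w => normalized_search_time (@pure_search _ _ s w) H).
Proof.
rewrite /normalized_search_time; case: (H == origin Q); first exact: measurable_cst.
apply: emeasurable_funM; last exact: measurable_cst.
exact: measurable_search_time.
Qed.

Lemma expected_ge0 (s : randomized_search Q) H :
  (0 <= expected_normalized_search_time s H)%E.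
Proof. by apply: integral_ge0 => w _; exact: normalized_search_time_ge0. Qed.

(** Hiding at the [k]-th grid point of each arc end with weight [1 / k] (the
    discrete log-uniform distribution).  The time bound of [search_time_grid]
    makes the weighted sum at least that of [rank / k ^ 2], to which
    [sum_rank_ge] and [sum_max_ge] apply. *)
Lemma weighted_normalized_time_ge (n K : nat) (a : 'I_n -> arc_of Q * bool)
    (h eta : R) S :
  injective a -> (forall i, starts_at_root (a i)) -> (forall i, has_room (a i) h) ->
  0 < eta -> (K.+1 + n * K.+1)%:R * eta <= h -> expanding_search S ->
  ((n%:R ^+ 2 * (harmonic_sum R K.+1 - 1))%:E <=
   \sum_(p : 'I_n * 'I_K.+1) (p.2.+1%:R^-1)%:E *
     normalized_search_time S (grid_point a eta p))%E.
Proof.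
move=> a_inj aO ah eta0 room expS.
pose T (p : 'I_n * 'I_K.+1) := search_time S (grid_point a eta p).
pose c (p : 'I_n * 'I_K.+1) := #|[pred q | (T q <= T p)%O]|.
apply: (@le_trans _ _ (\sum_(p : 'I_n * 'I_K.+1) ((c p)%:R / p.2.+1%:R ^+ 2)%:E)%E).
  rewrite sumEFin lee_fin -(ler_pM2l (ltr0Sn R 1)).
  apply: le_trans (@sum_rank_ge R _ (fun p : 'I_n * 'I_K.+1 => p.2.+1%:R) _ _ T _) => //.
  under eq_bigr do
    rewrite (sum_snd n (fun m : 'I_K.+1 => (Num.max _ m.+1%:R) ^- 2)).
  rewrite -mulr_sumr (sum_snd n (fun k : 'I_K.+1 =>
    \sum_(m < K.+1) (Num.max k.+1%:R m.+1%:R) ^- 2)).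
  by rewrite mulrCA [leRHS]mulrA -expr2 ler_wpM2l ?sqr_ge0//; exact: sum_max_ge.
apply: lee_sum => p _.
have kh : p.2.+1%:R * eta <= h.
  apply: le_trans room; rewrite ler_wpM2r ?ler_nat ?(ltW eta0)//.
  by rewrite (leq_trans (ltn_ord p.2))// leq_addr.
have k0 : 0 < p.2.+1%:R * eta by rewrite mulr_gt0.
have khh : p.2.+1%:R * eta <= h + h by lra.
have /andP[d0 dk] := end_point_dist (aO p.1) (ah p.1) k0 khh.
rewrite /normalized_search_time ifF; last first.
  by apply/eqP => HO; move: d0; rewrite -/(grid_point a eta p) HO root_dist_origin ltxx.
rewrite -/(grid_point a eta p) in d0 dk *.
apply: (@le_trans _ _ ((p.2.+1%:R^-1)%:E *
    (((c p)%:R * eta)%:E * ((p.2.+1%:R * eta)^-1)%:E))%E).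
  rewrite -!EFinM lee_fin le_eqVlt; apply/orP; left; apply/eqP.
  by field; rewrite ?gt_eqF.
apply: lee_wpmul2l; first by rewrite lee_fin.
apply: lee_pmul; rewrite ?lee_fin ?invr_ge0 ?mulr_ge0 ?(ltW eta0)//.
  exact: search_time_grid.
by rewrite lef_pV2.
Qed.

(** The supremum over hiding places is at least the weighted mean over the
    grid, whose total weight is [n] times a harmonic sum; integrating the pure
    bound gives the mean value [n - o(1)] as the harmonic sums diverge. *)
Lemma arc_ends_le_ratio (s : randomized_search Q) (n : nat)
    (a : 'I_n -> arc_of Q * bool) :
  injective a -> (forall i, starts_at_root (a i)) ->
  ((n%:R)%:E <= ereal_sup (range (expected_normalized_search_time s)))%E.
Proof.
move=> a_inj aO.
set V := ereal_sup _.
have EV H : (expected_normalized_search_time s H <= V)%E.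
  by apply: ereal_sup_ubound; exists H.
have V0 : (0 <= V)%E by apply: le_trans (EV (origin Q)); exact: expected_ge0.
have [->|Vfin] := eqVneq V +oo%E; first by rewrite leey.
have VE : V = (fine V)%:E by rewrite fineK// ge0_fin_numE// lt_neqAle Vfin leey.
rewrite VE lee_fin; apply: le_of_harmonic_sum; last by rewrite fine_ge0.
move=> K.
have [h h0 ah] := finite_room a.
pose eta := h / (K.+1 + n * K.+1)%:R.
have M0 : 0 < (K.+1 + n * K.+1)%:R :> R by rewrite ltr0n.
have eta0 : 0 < eta by rewrite divr_gt0.
have room : (K.+1 + n * K.+1)%:R * eta <= h by rewrite mulrC divfK// gt_eqF.
rewrite -lee_fin [leRHS]EFinM -VE.
have -> : ((n%:R * harmonic_sum R K.+1)%:E * V =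
    \sum_(p : 'I_n * 'I_K.+1) (p.2.+1%:R^-1)%:E * V)%E.
  rewrite -ge0_sume_distrl; last by move=> p _; rewrite lee_fin.
  by rewrite sumEFin (sum_snd n (fun k : 'I_K.+1 => k.+1%:R^-1)).
apply: (@le_trans _ _ (\sum_(p : 'I_n * 'I_K.+1) (p.2.+1%:R^-1)%:E *
    expected_normalized_search_time s (grid_point a eta p))%E); last first.
  by apply: lee_sum => p _; rewrite lee_wpmul2l// lee_fin.
rewrite (eq_bigr (fun p : 'I_n * 'I_K.+1 => \int[sample_law s]_w ((p.2.+1%:R^-1)%:E *
    normalized_search_time (@pure_search _ _ s w) (grid_point a eta p)))%E);
  last first.
  move=> p _; rewrite ge0_integralZl ?lee_fin//.
    exact: measurable_normalized_search_time.
  by move=> w _; exact: normalized_search_time_ge0.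
rewrite -ge0_integral_sum//; last 2 first.
- by move=> p; apply: measurable_funeM; exact: measurable_normalized_search_time.
- by move=> p w _; rewrite mule_ge0 ?lee_fin// normalized_search_time_ge0.
set c := (n%:R ^+ 2 * _)%R.
have -> : c%:E = (\int[sample_law s]_w c%:E)%E.
  by rewrite integral_cst//= probability_setT mule1.
apply: ge0_le_integral => //.
- by move=> _ _; rewrite lee_fin mulr_ge0 ?sqr_ge0// subr_ge0 harmonic_sum_ge1.
- apply: emeasurable_sum => p; apply: measurable_funeM.
  exact: measurable_normalized_search_time.
- move=> w _; apply: (weighted_normalized_time_ge a_inj aO ah eta0 room).
  exact: pure_searchP.
Qed.

Lemma ends_le_rho (u : seq (arc_of Q * bool)) :
  uniq u -> (forall a, a \in u -> starts_at_root a) -> ((size u)%:R%:E <= rho Q)%E.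
Proof.
move=> u_uniq uO; apply: le_ereal_inf_tmp => _ [s ->].
case: u => [|a0 u] in u_uniq uO *.
  apply: le_trans (expected_ge0 s (origin Q)) _.
  by apply: ereal_sup_ubound; exists (origin Q).
apply: (@arc_ends_le_ratio s _ (fun i => nth a0 (a0 :: u) i)).
  by move=> i j /eqP; rewrite nth_uniq// => /eqP; exact: ord_inj.
by move=> i; apply: uO; exact: mem_nth.
Qed.

Lemma rho_ge0 : (0 <= rho Q)%E.
Proof. exact: (@ends_le_rho [::]). Qed.

(** Arbitrarily many arc ends force an arbitrarily large ratio. *)
Lemma infinite_ends (b : bool) (A : set (arc_of Q)) : infinite_set A ->
  (forall e, A e -> starts_at_root (e, b)) -> rho Q = +oo%E.
Proof.
move=> infA AO; apply/eqyP => x x0.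
have [F FA nF] := infinite_set_fset (Num.bound x) infA.
apply: (@le_trans _ _ (#|` F|)%:R%:E).
  rewrite lee_fin (le_trans (ltW (archi_boundP (ltW x0))))// ler_nat//.
have := @ends_le_rho [seq (e, b) | e <- enum_fset F]; rewrite size_map.
apply; first by rewrite map_inj_uniq ?fset_uniq// => e e' [].
by move=> _ /mapP[e eF ->]; apply/AO/FA.
Qed.

Lemma degree_le_rho : (degree (root_vertex Q) <= rho Q)%E.
Proof.
rewrite /degree /counting; case: asboolP => [finA|]; last first.
  by move=> /(@infinite_ends false) ->; rewrite ?leey.
case: asboolP => [finB|]; last first.
  by move=> /(@infinite_ends true) ->; rewrite ?leey.
set A := fset_set _; set B := fset_set _.
have := @ends_le_rho ([seq (e, false) | e <- enum_fset A] ++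
                      [seq (e, true) | e <- enum_fset B]).
rewrite size_cat !size_map natrD EFinD; apply.
  rewrite cat_uniq !map_inj_uniq ?fset_uniq //=; try by move=> e e' [].
  by rewrite andbT; apply/hasPn => _ /mapP[e _ ->]; apply/mapP => -[].
move=> a; rewrite mem_cat => /orP[] /mapP[e + ->].
  by rewrite in_fset_set// => /set_mem.
by rewrite in_fset_set// => /set_mem.
Qed.

End Expectation.

(** * The competitive ratio of the disc search *)

Local Open Scope ereal_scope.

Theorem corollary12 (R : realType) (Q : network R) (alpha : R)
  (Q_pos : 0 < total_length Q)
  (Q_bounded : bounded_spheres Q)
  (alpha_gt1 : (1 < alpha)%R)
  (f_le : ereal_sup [set f_Q Q r * (r^-1)%:E | r in [set r : R | (0 < r)%R]]
            <= alpha%:E * degree (root_vertex Q)) :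
  ereal_sup (range (normalized_search_time (S_star Q)))
    <= alpha%:E * rho Q.
Proof.
have alpha_gt0 : (0 < alpha)%R by exact: lt_trans alpha_gt1.
have alpha_deg : alpha%:E * degree (root_vertex Q) <= alpha%:E * rho Q.
  by rewrite lee_wpmul2l ?lee_fin ?(ltW alpha_gt0)// degree_le_rho.
have [->|rho_fin] := eqVneq (rho Q) +oo; first by rewrite gt0_muley ?leey ?lte_fin.
apply: ge_ereal_sup => _ [x _ <-].
(* At distance 0 the normalized time is 0, by the convention [0^-1 = 0]. *)
have [d0|dN0] := eqVneq (root_dist x) 0%R.
  rewrite /normalized_search_time d0 invr0 mule0 if_same.
  by rewrite mule_ge0 ?rho_ge0// lee_fin ltW.
have d_gt0 : (0 < root_dist x)%R by rewrite lt_neqAle eq_sym dN0 root_dist_ge0.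
have fr : f_Q Q (root_dist x) * ((root_dist x)^-1)%:E <= alpha%:E * rho Q.
  apply: le_trans alpha_deg; apply: le_trans f_le.
  by apply: ereal_sup_ubound; exists (root_dist x).
apply: (le_trans _ fr); apply: normalized_S_star_le.
rewrite ltey; apply/eqP => f_oo; move: fr.
rewrite f_oo gt0_mulye ?lte_fin ?invr_gt0// leye_eq.
have -> : rho Q = (fine (rho Q))%:E.
  by rewrite fineK// ge0_fin_numE ?rho_ge0// lt_neqAle rho_fin leey.
by rewrite -EFinM.
Qed.
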